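(* Let $(X,\mathcal{U})$ be a $T_0$ bicomplete quasi-uniform space generated by a family $\mathcal{D}=\{d_\alpha\}_{\alpha\in A}$ of quasi-pseudometrics, and let $T,T'\colon X\to X$ be $\mathcal{D}$-contractions with common contraction constants $\{k_\alpha\}_{\alpha\in A}\subseteq[0,1)$ and unique fixed points $x^*,y^*\in X$ respectively. Then for every $\alpha\in A$, $$d_\alpha(x^*,y^* )\le\frac{1}{1-k_\alpha}\sup_{x\in X}d_\alpha(Tx,T'x)\quad\text{and}\quad d_\alpha(y^*,x^* )\le\frac{1}{1-k_\alpha}\sup_{x\in X}d_\alpha(T'x,Tx),$$ where the suprema are taken in $[0,\infty]$. In particular, if $\varepsilon:=\sup_{x\in X}d_\alpha^s(Tx,T'x)<\infty$, then $d_\alpha^s(x^*,y^* )\le\varepsilon/(1-k_\alpha)$.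
   Context: $X$ is a non-empty set. A quasi-uniformity on $X$ is a filter $\mathcal{U}$ on $X\times X$ such that every $U\in\mathcal{U}$ contains the diagonal $\Delta_X$ and for every $U\in\mathcal{U}$ there is $V\in\mathcal{U}$ with $V\circ V\subseteq U$, where $V\circ V=\{(x,z):\exists y,\ (x,y)\in V,\ (y,z)\in V\}$. The pair $(X,\mathcal{U})$ is a quasi-uniform space. Put $U^{-1}=\{(x,y):(y,x)\in U\}$. The symmetrisation $\mathcal{U}^s$ is the uniformity generated by the entourages $U\cap U^{-1}$, $U\in\mathcal{U}$. $\mathcal{U}$ is $T_0$ if the preorder $\bigcap\mathcal{U}:=\bigcap_{U\in\mathcal{U}}U$ is antisymmetric. $(X,\mathcal{U})$ is bicomplete if the uniform space $(X,\mathcal{U}^s)$ is complete (every net that is Cauchy for $\mathcal{U}^s$ converges in $\mathcal{U}^s$). A quasi-pseudometric on $X$ is a function $d\colon X\times X\to[0,\infty)$ with $d(x,x)=0$ and $d(x,z)\le d(x,y)+d(y,z)$; $d^{s}(x,y):=\max\{d(x,y),d(y,x)\}$. A family $\mathcal{D}$ of quasi-pseudometrics generates the quasi-uniformity having as subbase the sets $\{(x,y):d(x,y)<\varepsilon\}$, $d\in\mathcal{D}$, $\varepsilon>0$. A self-map $T\colon X\to X$ is a $\mathcal{D}$-contraction with constants $\{k_\alpha\}_{\alpha\in A}\subseteq[0,1)$ if for every $\alpha\in A$ and all $x,y\in X$, $d_\alpha(Tx,Ty)\le k_\alpha d_\alpha(x,y)$ and $d_\alpha(Ty,Tx)\le k_\alpha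 d_\alpha(y,x)$. (Under the stated hypotheses each such map has a unique fixed point.) *)

(* Defs.v *)
From mathcomp Require Import all_boot all_order all_algebra.
From mathcomp Require Import all_classical all_reals all_analysis.

Set Implicit Arguments.
Unset Strict Implicit.
Unset Printing Implicit Defensive.

Import Order.TTheory GRing.Theory Num.Theory.

Local Open Scope classical_set_scope.
Local Open Scope ring_scope.

Definition quasi_uniformity (X : Type) (U : set_system (X * X)) : Prop :=
  [/\ ProperFilter U,
      forall V, U V -> diagonal `<=` V &
      forall V, U V -> exists2 W, U W & (W \; W)%relation `<=` V].

Definition symmetrisation (X : Type) (U : set_system (X * X)) :
    set_system (X * X) :=
  smallest Filter [set V `&` (V^-1)%relation | V in U].

Definition qu_preorder (X : Type) (U : set_system (X * X)) : set (X * X) :=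
  \bigcap_(V in U) V.

Definition qu_T0 (X : Type) (U : set_system (X * X)) : Prop :=
  forall x y, qu_preorder U (x, y) -> qu_preorder U (y, x) -> x = y.

Definition directed (I : Type) (le : I -> I -> Prop) : Prop :=
  [/\ [set: I] !=set0,
      forall i, le i i,
      forall i j k, le i j -> le j k -> le i k &
      forall i j, exists2 k, le i k & le j k].

Definition net_cauchy (X : Type) (E : set_system (X * X))
    (I : Type) (le : I -> I -> Prop) (u : I -> X) : Prop :=
  forall V, E V ->
    exists i0, forall i j, le i0 i -> le i0 j -> V (u i, u j).

Definition net_cvg (X : Type) (E : set_system (X * X))
    (I : Type) (le : I -> I -> Prop) (u : I -> X) (l : X) : Prop :=
  forall V, E V -> exists i0, forall i, le i0 i -> V (l, u i).

Definition net_complete (X : Type) (E : set_system (X * X)) : Prop :=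
  forall (I : Type) (le : I -> I -> Prop) (u : I -> X),
    directed le -> net_cauchy E le u -> exists l, net_cvg E le u l.

Definition bicomplete (X : Type) (U : set_system (X * X)) : Prop :=
  net_complete (symmetrisation U).

Definition quasi_pseudometric (R : realType) (X : Type) (d : X -> X -> R) :
    Prop :=
  [/\ forall x y, 0 <= d x y,
      forall x, d x x = 0 &
      forall x y z, d x z <= d x y + d y z].

Definition qpm_sym (R : realType) (X : Type) (d : X -> X -> R) (x y : X) : R :=
  Num.max (d x y) (d y x).

Definition qpm_generated (R : realType) (X A : Type) (d : A -> X -> X -> R) :
    set_system (X * X) :=
  smallest Filter [set V | exists (a : A) (e : R),
    0 < e /\ V = [set xy | d a xy.1 xy.2 < e]].

Definition D_contraction (R : realType) (X A : Type) (d : A -> X -> X -> R)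
    (k : A -> R) (T : X -> X) : Prop :=
  (forall a, 0 <= k a < 1) /\
  forall a x y, d a (T x) (T y) <= k a * d a x y /\
                d a (T y) (T x) <= k a * d a y x.

(* Main.v *)
Require Import Defs.
From mathcomp Require Import all_boot all_order all_algebra.
From mathcomp Require Import all_classical all_reals all_analysis.
From mathcomp Require Import lra.

Import Order.TTheory GRing.Theory Num.Theory.

Local Open Scope classical_set_scope.
Local Open Scope ring_scope.

(** This is the perturbation estimate for Banach fixed points. Going from [xs] to [ys] through
    [T' xs], the first leg is the displacement of [T] against [T'] at [xs], at most the supremum;
    the second is at most [k a * d a xs ys] and is absorbed on the left since [k a < 1]. Exchanging
    the maps, with the detour through [T ys], gives the reverse distance. *)

(* [d x y = d (T x) (S y) <= d (T x) (S x) + c * d x y], then solve for [d x y]. *)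
Lemma fixed_point_dist_le (R : realType) (X : Type) (d : X -> X -> R)
    (T S : X -> X) (c : R) (s : \bar R) (x y : X) :
  quasi_pseudometric d -> c < 1 ->
  d (S x) (S y) <= c * d x y -> T x = x -> S y = y ->
  ((d (T x) (S x))%:E <= s)%E ->
  ((d x y)%:E <= ((1 - c)^-1)%:E * s)%E.
Proof.
move=> [_ _ d_tri] c_lt1 S_contr Tx Sy les.
have c1_gt0 : 0 < 1 - c by rewrite subr_gt0.
(* Division by [1 - c] takes place among the reals; the bound [s], possibly infinite, enters only by
   monotonicity. *)
apply: (@le_trans _ _ (((1 - c)^-1)%:E * (d (T x) (S x))%:E)%E); last first.
  by apply: lee_wpmul2l les; rewrite lee_fin invr_ge0 ltW.
rewrite -EFinM lee_fin mulrC ler_pdivlMr // Tx.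
move: (d_tri x (S x) y) S_contr; rewrite Sy => tri contr.
lra.
Qed.

Theorem proposition4p20 (R : realType) (X : Type) (X_neq0 : [set: X] !=set0)
    (A : Type) (d : A -> X -> X -> R) (U : set_system (X * X))
    (d_qpm : forall a, quasi_pseudometric (d a))
    (U_qu : quasi_uniformity U) (U_gen : U = qpm_generated d)
    (U_T0 : qu_T0 U) (U_bicomplete : bicomplete U)
    (k : A -> R) (T T' : X -> X)
    (T_contr : D_contraction d k T) (T'_contr : D_contraction d k T')
    (xs ys : X)
    (xs_fix : unique (fun x => T x = x) xs)
    (ys_fix : unique (fun x => T' x = x) ys) :
  forall a : A,
  [/\ ((d a xs ys)%:E <= ((1 - k a)^-1)%:E
         * ereal_sup (range (fun x => (d a (T x) (T' x))%:E)))%E,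
      ((d a ys xs)%:E <= ((1 - k a)^-1)%:E
         * ereal_sup (range (fun x => (d a (T' x) (T x))%:E)))%E &
      forall eps : \bar R,
        eps = ereal_sup (range (fun x => (qpm_sym (d a) (T x) (T' x))%:E)) ->
        (eps < +oo)%E ->
        ((qpm_sym (d a) xs ys)%:E <= eps * ((1 - k a)^-1)%:E)%E].
Proof.
case: T_contr T'_contr xs_fix ys_fix.
move=> k01 T_contr [_ T'_contr] [Txs _] [T'ys _] a.
have /andP[_ k_lt1] := k01 a.
have [T'_le _] := T'_contr a xs ys; have [T_le _] := T_contr a ys xs.
(* The bound [s] stays free: it becomes a one-sided supremum first, then the symmetrised one. *)
have xy_le s := @fixed_point_dist_le _ _ _ _ _ _ s _ _ (d_qpm a) k_lt1 T'_le Txs T'ys.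
have yx_le s := @fixed_point_dist_le _ _ _ _ _ _ s _ _ (d_qpm a) k_lt1 T_le T'ys Txs.
split; first by apply: xy_le; apply: ereal_sup_ubound; exists xs.
  by apply: yx_le; apply: ereal_sup_ubound; exists ys.
move=> _ -> _; set eps := ereal_sup _.
have sym_le x : ((qpm_sym (d a) (T x) (T' x))%:E <= eps)%E.
  by apply: ereal_sup_ubound; exists x.
(* Each directed distance is bounded separately, as each directed displacement is one entry of the
   maximum defining [qpm_sym]. *)
rewrite muleC {1}/qpm_sym EFin_max ge_max; apply/andP; split.
- by apply/xy_le/le_trans/(sym_le xs); rewrite lee_fin le_max lexx.
- by apply/yx_le/le_trans/(sym_le ys); rewrite lee_fin le_max lexx orbT.
Qed.
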